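(* Let $c\ge1$ be an integer. Then $I_{c,1}=\binom{c}{2}$ and for all $n\ge2$, $$I_{c,n}=c^n n!\,\frac{cn-1}{2}+cn\,I_{c,n-1}.$$
   Context: For integers $n\ge1$, $c\ge1$, let $G_{c,n}$ be the set of colored permutations: words $\sigma=\sigma_1^{[c_1]}\cdots\sigma_n^{[c_n]}$ where $|\sigma|=\sigma_1\cdots\sigma_n$ is a permutation of $[n]$ and each color $c_i\in\{0,\dots,c-1\}$. For a permutation $\pi$ of $[n]$, $\mathrm{inv}(\pi)=|\{(i,j):i<j,\ \pi_i>\pi_j\}|$. Let $\mathrm{col}(\sigma)=c_1+\cdots+c_n$ and $\mathrm{inv}_c(\sigma)=\mathrm{inv}(|\sigma|)+\mathrm{col}(\sigma)+c\cdot|\{(i,j):1\le i<j\le n,\ \sigma_i<\sigma_j,\ c_j\ne0\}|$. Let $I_{c,n}=\sum_{\sigma\in G_{c,n}}\mathrm{inv}_c(\sigma)$ be the total number of colored inversions. *)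

(* Defs.v *)
From mathcomp Require Import all_boot all_fingroup.

Set Implicit Arguments.
Unset Strict Implicit.
Unset Printing Implicit Defensive.

(* The word sigma_1^[c_1] ... sigma_n^[c_n] is the pair of the underlying
   permutation i |-> sigma_i and the coloring i |-> c_i, both indexed by
   position; positions and letters are numbered from 0. *)
Definition colored_perm (c n : nat) : finType := ('S_n * {ffun 'I_n -> 'I_c})%type.

Definition inv (n : nat) (p : 'S_n) : nat :=
  #|[set ij : 'I_n * 'I_n | (ij.1 < ij.2) && (p ij.1 > p ij.2)]|.

Definition col (c n : nat) (s : colored_perm c n) : nat := \sum_(i < n) s.2 i.

Definition inv_c (c n : nat) (s : colored_perm c n) : nat :=
  inv s.1 + col s +
  c * #|[set ij : 'I_n * 'I_n |
          [&& ij.1 < ij.2, s.1 ij.1 < s.1 ij.2 & s.2 ij.2 != 0 :> nat]]|.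

Definition total_inv (c n : nat) : nat := \sum_(s : colored_perm c n) inv_c s.

(* Main.v *)
Require Import Defs.
From mathcomp Require Import all_boot all_order all_fingroup all_algebra.
From mathcomp Require Import zify ring.

(** Swapping the letters at positions i and j shows that p i < p j for half of
    the permutations p, and the colors of distinct positions are independent.
    Summing over positions and pairs of positions therefore gives
    [2 I_{c,n} = c^n n! (c 'C(n, 2) + n (c - 1))], from which the recurrence is
    a polynomial identity. *)

Import GRing.Theory.
Local Open Scope ring_scope.

Section Counting.

Local Open Scope nat_scope.

(** Keeping [P] as the index range leaves a sum over a fixed set of pairs, which can then be
    exchanged with the sums over permutations and colorings. *)
Lemma card_sumb (T : finType) (P Q : pred T) :
  #|[set x | P x && Q x]| = \sum_(x | P x) Q x.
Proof.
rewrite cardsE -sum1_card big_mkcondr /=.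
by apply: eq_bigr => x _; case: (Q x).
Qed.

(** Grouped by the larger entry [j], the pairs contribute [j] each. *)
Lemma sum_ord_ltn_pairs (n : nat) :
  \sum_(ij : 'I_n * 'I_n | ij.1 < ij.2) 1 = 'C(n, 2).
Proof.
rewrite -bin2_sum big_mkord.
rewrite big_mkcond -(pair_bigA _ (fun i j : 'I_n => if i < j then 1 else 0)) /=.
rewrite exchange_big /=; apply: eq_bigr => j _.
rewrite -big_mkcond /= (big_ord_narrow (ltnW (ltn_ord j))) /=.
by rewrite sum1_card card_ord.
Qed.

Lemma sum_perm_ltn (n : nat) (i j : 'I_n) : i != j ->
  (\sum_(p : 'S_n) (p i < p j)) * 2 = n`!.
Proof.
move=> ij; rewrite muln2 -addnn.
(* Precomposing one copy of the sum with [tperm i j] swaps [p i] and [p j], so the two indicators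
   add up to 1 for each [p]. *)
rewrite [X in X + _](reindex_inj (mulgI (tperm i j))) /= -big_split /=.
rewrite -[RHS]card_Sn -sum1_card.
apply: eq_big => [p|p _]; first by rewrite inE.
rewrite !permM tpermL tpermR.
have : p i != p j by rewrite (inj_eq perm_inj).
by rewrite -val_eqE /=; case: ltngtP.
Qed.

Lemma sum_ffun_eval (c n : nat) (j : 'I_n) (F : 'I_c -> nat) :
  \sum_(f : {ffun 'I_n -> 'I_c}) F (f j) = c ^ n.-1 * \sum_k F k.
Proof.
(* With weight 1 away from [j], the summand is a product over positions, and the sum over colorings
   becomes a product of sums over colors. *)
pose G (i : 'I_n) k := if i == j then F k else 1.
transitivity (\sum_(f : {ffun 'I_n -> 'I_c}) \prod_i G i (f i)).
  apply: eq_bigr => f _; rewrite (bigD1 j) //= /G eqxx big1 ?muln1 //.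
  by move=> i /negbTE ->.
rewrite -bigA_distr_bigA (bigD1 j) //= mulnC; congr (_ * _); last first.
  by apply: eq_bigr => k _; rewrite /G eqxx.
rewrite (eq_bigr (fun=> c)) => [|i /negbTE ij].
  by rewrite prod_nat_const cardC1 card_ord.
by rewrite /G ij sum1_card card_ord.
Qed.

Lemma sum_ord_neq0 (c : nat) : \sum_(k < c) (k != 0 :> nat) = c.-1.
Proof.
case: c => [|c]; first by rewrite big_ord0.
by rewrite big_ord_recl /= sum1_card card_ord.
Qed.

Lemma sum_inv (n : nat) : (\sum_(p : 'S_n) Defs.inv p) * 2 = n`! * 'C(n, 2).
Proof.
rewrite /Defs.inv; under eq_bigr do rewrite card_sumb.
rewrite exchange_big big_distrl /= -sum_ord_ltn_pairs big_distrr /=.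
apply: eq_bigr => -[i j] /= ij.
by rewrite muln1 sum_perm_ltn // -val_eqE /= gtn_eqF.
Qed.

Lemma sum_col (c n : nat) :
  (\sum_(f : {ffun 'I_n -> 'I_c}) \sum_(i < n) f i) * 2 = c ^ n * (n * c.-1).
Proof.
rewrite exchange_big /=.
under eq_bigr do rewrite (sum_ffun_eval _ _ _ (fun k : 'I_c => k : nat)).
rewrite sum_nat_const card_ord -(big_mkord xpredT (fun k => k)) bin2_sum.
(* The absorption identity gives [2 * 'C(c, 2) = c.-1 * c], whose factor [c] completes [c ^ n] to
   [c ^ n.+1]. *)
case: n => [|n] //=; have := mul_bin_left c 1; rewrite bin1 expnS subn1.
by nia.
Qed.

Lemma sum_noninv_colored (c n : nat) :
  (\sum_(p : 'S_n) \sum_(f : {ffun 'I_n -> 'I_c})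
     #|[set ij : 'I_n * 'I_n |
         [&& ij.1 < ij.2, p ij.1 < p ij.2 & f ij.2 != 0 :> nat]]|) * 2
  = n`! * (c ^ n.-1 * c.-1) * 'C(n, 2).
Proof.
under eq_bigr do under eq_bigr do rewrite card_sumb.
under eq_bigr do rewrite exchange_big.
rewrite exchange_big big_distrl /= -sum_ord_ltn_pairs big_distrr /=.
apply: eq_bigr => -[i j] /= ij.
(* The indicator of the conjunction is a product, which separates the sum over [p] from the sum over
   [f]. *)
under eq_bigr do (under eq_bigr do rewrite -mulnb; rewrite -big_distrr).
rewrite -big_distrl /= mulnAC sum_perm_ltn; last by rewrite -val_eqE /= ltn_eqF.
by rewrite (sum_ffun_eval _ _ _ (fun k : 'I_c => k != 0 :> nat)) sum_ord_neq0 muln1.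
Qed.

Lemma total_inv_closed (c n : nat) :
  total_inv c n * 2 = c ^ n * n`! * (c * 'C(n, 2) + n * c.-1).
Proof.
have -> : total_inv c n = \sum_(p : 'S_n) \sum_(f : {ffun 'I_n -> 'I_c})
    inv_c ((p, f) : colored_perm c n).
  by rewrite pair_bigA; apply: eq_bigr => -[].
under eq_bigr do rewrite !big_split /= -big_distrr /=.
rewrite !big_split /= -big_distrr /= !mulnDl -(mulnA c) sum_noninv_colored.
under eq_bigr do rewrite sum_nat_const card_ffun !card_ord.
rewrite -big_distrr /= -[X in X + _ + _]mulnA sum_inv.
rewrite /Defs.col /= big_const iter_addn_0 card_Sn [X in _ + X + _]mulnAC.
rewrite sum_col.
case: n => [|n] /=; first by rewrite !(mul0n, muln0).
rewrite expnS; case: c => [|c] /=; first by rewrite !(mul0n, muln0).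
by ring.
Qed.

End Counting.

Theorem theorem3p7 (c : nat) (hc : (1 <= c)%N) :
  total_inv c 1 = 'C(c, 2) /\
  forall n : nat, (2 <= n)%N ->
    (total_inv c n)%:R =
      c%:R ^+ n * n`!%:R * ((c%:R * n%:R - 1) / 2)
      + c%:R * n%:R * (total_inv c (n - 1)%N)%:R :> rat.
Proof.
split.
  have := total_inv_closed c 1; have := mul_bin_left c 1.
  rewrite bin1 expn1 subn1 (bin_small (ltnSn 1)) muln0 add0n mul1n factS fact0 !muln1.
  by nia.
case=> [|[|n]] // _; rewrite subn1 /=.
have total_rat m : (total_inv c m)%:R = c%:R ^+ m * m`!%:R *
    (c%:R * 'C(m, 2)%:R + m%:R * (c%:R - 1)) / 2 :> rat.
  apply: (canRL (mulfK _)) => //.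
  rewrite -(natrM _ _ 2) total_inv_closed !(natrM, natrD, natrX).
  (* Positivity of [c] turns the truncated predecessor into the rational [c - 1]. *)
  by rewrite -subn1 (natrB _ hc).
(* Pascal's rule leaves the same binomial coefficient on both sides, where it cancels. *)
rewrite !total_rat binS bin1 factS exprS !(natrM, natrD).
by field.
Qed.
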